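(* Let $G$ be a set and $\alpha_G:G\to\mathbf N$ a function. The category $\mathcal{WO}_u$ determined by $G$ and $\alpha_G$ is a preorder; i.e., for any two objects $f,g$ of $\mathcal{WO}_u$ there is at most one arrow from $f$ to $g$.
   Context: **Words and nominal arities.** An $\mathbf N^+$-word is a finite (possibly empty) sequence of positive integers; $e$ is the empty word and $ab$ is the concatenation of $a$ and $b$. A nominal arity is a set of $\mathbf N^+$-words that contains no two distinct words of the form $a$ and $ab$. A word $a$ is a prefix of a nominal arity $X$ if $a$ is an initial segment (not necessarily proper) of every member of $X$; $P_X$ is the set of prefixes of $X$ (every word is a prefix of $\emptyset$). Put $a\cdot X=\{ab\mid b\in X\}$. If $a\in P_X\cap Y$, put $Y\triangleleft_a X=(Y\setminus\{a\})\cup X$, which is a nominal arity. For $n\ge 0$, $\bar n=\{1,\dots,n\}$ (one-letter words), $\bar 0=\emptyset$. **Objects.** The objects of $\mathcal{WO}_u$ are the terms of $\mathcal O_u$ (formal expressions, not identified by any equations), defined inductively together with a nominal arity $s(f)$ and an $\mathbf N^+$-word $t(f)$ for each term $f$: (0) for $x\in G$ and a word $a$, $a\cdot x$ is a term, with $s(a\cdot x)=a\cdot\overline{\alpha_G(x)}$ if $\alpha_G(x)\neq1$, $s(a\cdot x)=\{a\}$ if $\alpha_G(x)=1$, and $t(a\cdot x)=a$; (1) for a word $a$, $a\cdot\mathbf I$ is a term, $s(a\cdot\mathbf I)=\{a\}$, $t(a\cdot\mathbf I)=a$; (2) if $f,g$ are terms and $t(f)\in s(g)$, then $g\triangleleft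 f$ is a term, $s(g\triangleleft f)=s(g)\triangleleft_{t(f)}s(f)$, $t(g\triangleleft f)=t(g)$. (One always has $t(f)\in P_{s(f)}$.) **Arrow terms.** The basic arrow terms are, for all terms and words such that the following conditions hold: - $\mathbf 1_f:f\to f$; - $\beta_{h,g,f}:(h\triangleleft g)\triangleleft f\to h\triangleleft(g\triangleleft f)$ and $\beta^{-1}_{h,g,f}:h\triangleleft(g\triangleleft f)\to(h\triangleleft g)\triangleleft f$, where $t(g)\in s(h)$, $t(f)\in s(g)$; - $\theta_{h,g,f}:(h\triangleleft g)\triangleleft f\to(h\triangleleft f)\triangleleft g$, where $t(g),t(f)\in s(h)$, $t(g)\ne t(f)$; - $\mu_{f,a}:f\triangleleft a\cdot\mathbf I\to f$ and $\mu^{-1}_{f,a}:f\to f\triangleleft a\cdot\mathbf I$, where $a\in s(f)$; - $\lambda_f:t(f)\cdot\mathbf I\triangleleft f\to f$ and $\lambda^{-1}_f:f\to t(f)\cdot\mathbf I\triangleleft f$. Arrow terms are closed under composition ($v\circ u:f\to h$ for $u:f\to g$, $v:g\to h$) and under insertion: if $u:f\to f'$ and $v:g\to g'$ are arrow terms and $g\triangleleft f$, $g'\triangleleft f'$ are terms, then $v\triangleleft u:g\triangleleft f\to g'\triangleleft f'$ is an arrow term. **Equations.** The arrows of $\mathcal{WO}_u$ are the equivalence classes of arrow terms under the smallest equivalence relation $=$ (between arrow terms of the same type) that is a congruence for $\circ$ and $\triangleleft$, satisfies the category axioms ($u\circ\mathbf 1_f=u=\mathbf 1_g\circ u$ for $u:f\to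 g$; associativity of $\circ$), and contains all instances of the following in which both sides are well-formed arrow terms: - $\mathbf 1_g\triangleleft\mathbf 1_f=\mathbf 1_{g\triangleleft f}$; $(v_2\circ v_1)\triangleleft(u_2\circ u_1)=(v_2\triangleleft u_2)\circ(v_1\triangleleft u_1)$; - for $u:f_1\to f_2$, $v:g_1\to g_2$, $w:h_1\to h_2$: $\beta_{h_2,g_2,f_2}\circ((w\triangleleft v)\triangleleft u)=(w\triangleleft(v\triangleleft u))\circ\beta_{h_1,g_1,f_1}$ and $\theta_{h_2,g_2,f_2}\circ((w\triangleleft v)\triangleleft u)=((w\triangleleft u)\triangleleft v)\circ\theta_{h_1,g_1,f_1}$; - $\beta_{h,g,f}$ and $\beta^{-1}_{h,g,f}$ are mutually inverse; $\theta_{h,f,g}\circ\theta_{h,g,f}=\mathbf 1_{(h\triangleleft g)\triangleleft f}$; - $(\mathbf 1_j\triangleleft\beta_{h,g,f})\circ\beta_{j,h\triangleleft g,f}\circ(\beta_{j,h,g}\triangleleft\mathbf 1_f)=\beta_{j,h,g\triangleleft f}\circ\beta_{j\triangleleft h,g,f}$; - $\theta_{j\triangleleft f,h,g}\circ(\theta_{j,h,f}\triangleleft\mathbf 1_g)\circ\theta_{j\triangleleft h,g,f}=(\theta_{j,g,f}\triangleleft\mathbf 1_h)\circ\theta_{j\triangleleft g,h,f}\circ(\theta_{j,h,g}\triangleleft\mathbf 1_f)$; - $(\mathbf 1_j\triangleleft\theta_{h,g,f})\circ\beta_{j,h\triangleleft g,f}\circ(\beta_{j,h,g}\triangleleft\mathbf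 1_f)=\beta_{j,h\triangleleft f,g}\circ(\beta_{j,h,f}\triangleleft\mathbf 1_g)\circ\theta_{j\triangleleft h,g,f}$; - $\theta_{j,h\triangleleft g,f}\circ(\beta_{j,h,g}\triangleleft\mathbf 1_f)=\beta_{j\triangleleft f,h,g}\circ(\theta_{j,h,f}\triangleleft\mathbf 1_g)\circ\theta_{j\triangleleft h,g,f}$; - for $u:f_1\to f_2$: $\mu_{f_2,a}\circ(u\triangleleft\mathbf 1_{a\cdot\mathbf I})=u\circ\mu_{f_1,a}$ and $\lambda_{f_2}\circ(\mathbf 1_{t(f_1)\cdot\mathbf I}\triangleleft u)=u\circ\lambda_{f_1}$; $\mu,\mu^{-1}$ and $\lambda,\lambda^{-1}$ (with the same indices) are mutually inverse; - $\beta_{h,t(f)\cdot\mathbf I,f}=(\mathbf 1_h\triangleleft\lambda^{-1}_f)\circ(\mu_{h,t(f)}\triangleleft\mathbf 1_f)$; $\theta_{h,b\cdot\mathbf I,f}=\mu^{-1}_{h\triangleleft f,b}\circ(\mu_{h,b}\triangleleft\mathbf 1_f)$. *)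

(* Defs.v *)
From mathcomp Require Import all_boot finmap.
From mathcomp Require Import boolp classical_sets.

Set Implicit Arguments.
Unset Strict Implicit.
Unset Printing Implicit Defensive.

Local Open Scope fset_scope.

(** ** Words and nominal arities *)

Definition letter : Type := {n : nat | 0 < n}.

Notation word := (seq letter).

(* Only finite nominal arities occur as [source f], hence the use of [fset]. *)
Definition nominal_arity (X : {fset word}) : Prop :=
  forall a b : word, a \in X -> a ++ b \in X -> a = a ++ b.

Definition prefix_of_arity (a : word) (X : {fset word}) : Prop :=
  forall b : word, b \in X -> prefix a b.

Definition dotw (a : word) (X : {fset word}) : {fset word} :=
  [fset a ++ b | b in X].

Definition insw (Y : {fset word}) (a : word) (X : {fset word}) : {fset word} :=
  (Y `\ a) `|` X.

Definition nat_letter (i : nat) : letter := exist _ i.+1 (ltn0Sn i).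

(* The letters 1, ..., n are the [nat_letter i] for i < n. *)
Definition barn (n : nat) : {fset word} :=
  [fset [:: nat_letter i] | i in iota 0 n].

(** ** Terms *)

(* Formal expressions, including those [g ◁ f] in which [target f] is not in
   [source g]; these are ruled out by [is_term]. *)
Inductive preterm (G : Type) : Type :=
| Gen of word & G
| Unit of word
| Ins of preterm G & preterm G.

Arguments Unit {G} a.

Declare Scope preterm_scope.
Delimit Scope preterm_scope with trm.
Bind Scope preterm_scope with preterm.
Arguments Ins {G} (g f)%_trm.
Notation "g ◁ f" := (Ins g f) (at level 40, left associativity) : preterm_scope.

Fixpoint target (G : Type) (f : preterm G) : word :=
  match f with
  | Gen a _ => a
  | Unit a => a
  | Ins g _ => target g
  end.

Fixpoint source (G : Type) (alpha : G -> nat) (f : preterm G) : {fset word} :=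
  match f with
  | Gen a x => if alpha x == 1 then [fset a] else dotw a (barn (alpha x))
  | Unit a => [fset a]
  | Ins g f => insw (source alpha g) (target f) (source alpha f)
  end.

Fixpoint is_term (G : Type) (alpha : G -> nat) (f : preterm G) : bool :=
  match f with
  | Gen _ _ | Unit _ => true
  | Ins g f =>
      [&& is_term alpha g, is_term alpha f & target f \in source alpha g]
  end.

(** ** Arrow terms *)

(* Arrow expressions, before any typing; in [Comp v u] and [ArrIns v u] the
   arguments are in the order of the notations v ∘ u and v ◁ u. *)
Inductive prearrow (G : Type) : Type :=
| Id of preterm G
| Beta of preterm G & preterm G & preterm G
| BetaInv of preterm G & preterm G & preterm G
| Theta of preterm G & preterm G & preterm G
| Mu of preterm G & word
| MuInv of preterm G & word
| Lam of preterm G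
| LamInv of preterm G
| Comp of prearrow G & prearrow G
| ArrIns of prearrow G & prearrow G.

Declare Scope prearrow_scope.
Delimit Scope prearrow_scope with arr.
Bind Scope prearrow_scope with prearrow.
Arguments Comp {G} (v u)%_arr.
Arguments ArrIns {G} (v u)%_arr.
Notation "v ∘ u" := (Comp v u) (at level 50, left associativity) : prearrow_scope.
Notation "v ◁ u" := (ArrIns v u) (at level 40, left associativity) : prearrow_scope.

Section Arrows.

Context (G : Type) (alpha : G -> nat).

Local Notation term := (is_term alpha).
Local Notation s := (source alpha).
Local Notation t := (@target G).

(* [arrow_term u f g] : u is an arrow term of type f -> g. *)
Inductive arrow_term : prearrow G -> preterm G -> preterm G -> Prop :=
| at_id f : term f -> arrow_term (Id f) f f
| at_beta h g f : term h -> term g -> term f -> t g \in s h -> t f \in s g ->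
    arrow_term (Beta h g f) ((h ◁ g) ◁ f) (h ◁ (g ◁ f))
| at_betaV h g f : term h -> term g -> term f -> t g \in s h -> t f \in s g ->
    arrow_term (BetaInv h g f) (h ◁ (g ◁ f)) ((h ◁ g) ◁ f)
| at_theta h g f : term h -> term g -> term f ->
    t g \in s h -> t f \in s h -> t g != t f ->
    arrow_term (Theta h g f) ((h ◁ g) ◁ f) ((h ◁ f) ◁ g)
| at_mu f a : term f -> a \in s f -> arrow_term (Mu f a) (f ◁ Unit a) f
| at_muV f a : term f -> a \in s f -> arrow_term (MuInv f a) f (f ◁ Unit a)
| at_lam f : term f -> arrow_term (Lam f) (Unit (t f) ◁ f) f
| at_lamV f : term f -> arrow_term (LamInv f) f (Unit (t f) ◁ f)
| at_comp u v f g h : arrow_term u f g -> arrow_term v g h ->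
    arrow_term (v ∘ u) f h
| at_ins u v f f' g g' : arrow_term u f f' -> arrow_term v g g' ->
    term (g ◁ f)%trm -> term (g' ◁ f')%trm ->
    arrow_term (v ◁ u) (g ◁ f) (g' ◁ f').

(* The equation schemes; the requirement that both sides be arrow terms of the
   same type is imposed in [arrow_eq], rule [ae_ax]. *)
Inductive arrow_ax : prearrow G -> prearrow G -> Prop :=
| ax_idr u f g : arrow_term u f g -> arrow_ax (u ∘ Id f) u
| ax_idl u f g : arrow_term u f g -> arrow_ax (Id g ∘ u) u
| ax_assoc w v u : arrow_ax ((w ∘ v) ∘ u) (w ∘ (v ∘ u))
| ax_ins_id g f : arrow_ax (Id g ◁ Id f) (Id (g ◁ f))
| ax_ins_comp v2 v1 u2 u1 :
    arrow_ax ((v2 ∘ v1) ◁ (u2 ∘ u1)) ((v2 ◁ u2) ∘ (v1 ◁ u1))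
| ax_beta_nat u v w f1 f2 g1 g2 h1 h2 :
    arrow_term u f1 f2 -> arrow_term v g1 g2 -> arrow_term w h1 h2 ->
    arrow_ax (Beta h2 g2 f2 ∘ ((w ◁ v) ◁ u)) ((w ◁ (v ◁ u)) ∘ Beta h1 g1 f1)
| ax_theta_nat u v w f1 f2 g1 g2 h1 h2 :
    arrow_term u f1 f2 -> arrow_term v g1 g2 -> arrow_term w h1 h2 ->
    arrow_ax (Theta h2 g2 f2 ∘ ((w ◁ v) ◁ u)) (((w ◁ u) ◁ v) ∘ Theta h1 g1 f1)
| ax_betaK h g f :
    arrow_ax (BetaInv h g f ∘ Beta h g f) (Id ((h ◁ g) ◁ f))
| ax_betaVK h g f :
    arrow_ax (Beta h g f ∘ BetaInv h g f) (Id (h ◁ (g ◁ f)))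
| ax_thetaK h g f :
    arrow_ax (Theta h f g ∘ Theta h g f) (Id ((h ◁ g) ◁ f))
| ax_beta_pentagon j h g f :
    arrow_ax
      ((Id j ◁ Beta h g f) ∘ Beta j (h ◁ g) f ∘ (Beta j h g ◁ Id f))
      (Beta j h (g ◁ f) ∘ Beta (j ◁ h) g f)
| ax_theta_hexagon j h g f :
    arrow_ax
      (Theta (j ◁ f) h g ∘ (Theta j h f ◁ Id g) ∘ Theta (j ◁ h) g f)
      ((Theta j g f ◁ Id h) ∘ Theta (j ◁ g) h f ∘ (Theta j h g ◁ Id f))
| ax_beta_theta1 j h g f :
    arrow_ax
      ((Id j ◁ Theta h g f) ∘ Beta j (h ◁ g) f ∘ (Beta j h g ◁ Id f))
      (Beta j (h ◁ f) g ∘ (Beta j h f ◁ Id g) ∘ Theta (j ◁ h) g f)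
| ax_beta_theta2 j h g f :
    arrow_ax
      (Theta j (h ◁ g) f ∘ (Beta j h g ◁ Id f))
      (Beta (j ◁ f) h g ∘ (Theta j h f ◁ Id g) ∘ Theta (j ◁ h) g f)
| ax_mu_nat u f1 f2 a : arrow_term u f1 f2 ->
    arrow_ax (Mu f2 a ∘ (u ◁ Id (Unit a))) (u ∘ Mu f1 a)
| ax_lam_nat u f1 f2 : arrow_term u f1 f2 ->
    arrow_ax (Lam f2 ∘ (Id (Unit (t f1)) ◁ u)) (u ∘ Lam f1)
| ax_muK f a : arrow_ax (MuInv f a ∘ Mu f a) (Id (f ◁ Unit a))
| ax_muVK f a : arrow_ax (Mu f a ∘ MuInv f a) (Id f)
| ax_lamK f : arrow_ax (LamInv f ∘ Lam f) (Id (Unit (t f) ◁ f))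
| ax_lamVK f : arrow_ax (Lam f ∘ LamInv f) (Id f)
| ax_beta_unit h f :
    arrow_ax (Beta h (Unit (t f)) f) ((Id h ◁ LamInv f) ∘ (Mu h (t f) ◁ Id f))
| ax_theta_unit h b f :
    arrow_ax (Theta h (Unit b) f) (MuInv (h ◁ f) b ∘ (Mu h b ◁ Id f)).

(* [arrow_eq f g u v] : u and v are equal arrow terms of type f -> g. *)
Inductive arrow_eq :
  preterm G -> preterm G -> prearrow G -> prearrow G -> Prop :=
| ae_ax f g u v : arrow_ax u v -> arrow_term u f g -> arrow_term v f g ->
    arrow_eq f g u v
| ae_refl f g u : arrow_term u f g -> arrow_eq f g u u
| ae_sym f g u v : arrow_eq f g u v -> arrow_eq f g v u
| ae_trans f g u v w : arrow_eq f g u v -> arrow_eq f g v w -> arrow_eq f g u w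
| ae_comp f g h u u' v v' : arrow_eq f g u u' -> arrow_eq g h v v' ->
    arrow_eq f h (v ∘ u) (v' ∘ u')
| ae_ins f f' g g' u u' v v' : arrow_eq f f' u u' -> arrow_eq g g' v v' ->
    term (g ◁ f)%trm -> term (g' ◁ f')%trm ->
    arrow_eq (g ◁ f) (g' ◁ f') (v ◁ u) (v' ◁ u').

End Arrows.

Lemma arrow_termP (G : Type) (alpha : G -> nat) u (f g : preterm G) :
  arrow_term alpha u f g -> is_term alpha f /\ is_term alpha g.
Proof.
elim=> {u f g} //=.
- by move=> h g f -> -> -> hg gf; rewrite /insw !inE hg gf orbT.
- by move=> h g f -> -> -> hg gf; rewrite /insw !inE hg gf orbT.
- move=> h g f -> -> -> hg hf ne.
  by rewrite /insw !inE hg hf ne eq_sym ne.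
- by move=> f a -> ->.
- by move=> f a -> ->.
- by move=> f ->; rewrite inE eqxx.
- by move=> f ->; rewrite inE eqxx.
- by move=> u v f g h _ [-> _] _ [_ ->].
Qed.

Lemma arrow_eqP (G : Type) (alpha : G -> nat) (f g : preterm G) u v :
  arrow_eq alpha f g u v -> arrow_term alpha u f g /\ arrow_term alpha v f g.
Proof.
elim=> {f g u v} //.
- by move=> f g u v _ [].
- by move=> f g u v w _ [? _] _ [].
- by move=> f g h u u' v v' _ [? ?] _ [? ?]; split; apply: at_comp; eassumption.
- by move=> f f' g g' u u' v v' _ [? ?] _ [? ?] ? ?; split; apply: at_ins.
Qed.

Lemma prefix_cat_total (a b c d : word) :
  a ++ b = c ++ d -> prefix a c \/ prefix c a.
Proof.
elim: a c => [|x a IH] [|y c] /=; [by left|by left|by right|].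
by case=> -> /IH; rewrite !eqxx.
Qed.

Lemma source_arity (G : Type) (alpha : G -> nat) (f : preterm G) :
  is_term alpha f ->
  nominal_arity (source alpha f) /\ prefix_of_arity (target f) (source alpha f).
Proof.
have arity1 (c : word) :
    nominal_arity [fset c] /\ prefix_of_arity c [fset c].
  split=> [a b|b]; first by rewrite !inE => /eqP-> /eqP->.
  by rewrite inE => /eqP->; exact: prefix_refl.
elim: f => [c x _|c _|g IHg f IHf] /=; [|exact: arity1|].
  case: eqP => _; first exact: arity1.
  split=> [a b|b]; last first.
    by case/imfsetP=> d _ ->; exact: prefix_prefix.
  case/imfsetP=> d /imfsetP[i _ ->] ->.
  case/imfsetP=> d' /imfsetP[j _ ->] /eqP.
  rewrite -catA eqseq_cat // eqxx /= => /andP[_].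
  by case: b => //; rewrite cats0.
case/and3P=> /IHg [ng pg] /IHf [nf pf] tfg; split; last first.
  move=> b; rewrite /insw !inE => /orP[/andP[_]|/pf]; first exact: pg.
  exact/prefix_trans/pg.
move=> a b; rewrite /insw !inE.
case/orP=> [/andP[a_t ag]|af] /orP[/andP[ab_t abg]|abf].
- exact: ng.
- have /prefixP[c abE] := pf _ abf; case/eqP: a_t.
  have [/prefixP[d tE]|/prefixP[d aE]] := prefix_cat_total abE.
    by rewrite tE; apply: ng; rewrite -?tE.
  by rewrite aE; symmetry; apply: ng; rewrite -?aE.
- have /prefixP[c aE] := pf _ af; case/eqP: ab_t; symmetry.
  by rewrite aE -catA; apply: ng => //; rewrite catA -aE.
- exact: nf.
Qed.

(** ** The category WO_u *)

Record category : Type := Category {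
  Obj : Type;
  Hom : Obj -> Obj -> Type;
  idm : forall x, Hom x x;
  comp : forall x y z, Hom y z -> Hom x y -> Hom x z;
  comp1m : forall x y (u : Hom x y), comp (idm y) u = u;
  compm1 : forall x y (u : Hom x y), comp u (idm x) = u;
  compmA : forall x y z t (w : Hom z t) (v : Hom y z) (u : Hom x y),
    comp (comp w v) u = comp w (comp v u) }.

Arguments Hom : clear implicits.

Definition is_preorder (C : category) : Prop :=
  forall (x y : Obj C) (u v : Hom C x y), u = v.

Section WOu.

Context (G : Type) (alpha : G -> nat).

Local Open Scope classical_set_scope.

Definition WOu_obj : Type := {f : preterm G | is_term alpha f}.

Definition arrow_class (f g : preterm G) (u : prearrow G) : set (prearrow G) :=
  [set v | arrow_eq alpha f g u v].

Definition WOu_hom (f g : WOu_obj) : Type :=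
  {A : set (prearrow G) |
    exists2 u, arrow_term alpha u (val f) (val g)
             & A = arrow_class (val f) (val g) u}.

Definition class_of (f g : WOu_obj) (u : prearrow G)
    (hu : arrow_term alpha u (val f) (val g)) : WOu_hom f g :=
  exist _ (arrow_class (val f) (val g) u) (ex_intro2 _ _ u hu erefl).

Lemma WOu_homP (f g : WOu_obj) (A : WOu_hom f g) :
  exists u, exists hu : arrow_term alpha u (val f) (val g), A = class_of hu.
Proof. by case: A => A [u hu AE]; exists u, hu; subst A. Qed.

Lemma WOu_hom_inj (f g : WOu_obj) (A B : WOu_hom f g) :
  sval A = sval B -> A = B.
Proof.
by case: A B => [A pA] [B pB] /= AB; subst B; congr exist; exact: Prop_irrelevance.
Qed.

Lemma class_of_eq (f g : WOu_obj) u v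
    (hu : arrow_term alpha u (val f) (val g))
    (hv : arrow_term alpha v (val f) (val g)) :
  arrow_eq alpha (val f) (val g) u v -> class_of hu = class_of hv.
Proof.
move=> uv; apply: WOu_hom_inj; apply/seteqP; split=> w /=.
- by apply: ae_trans; exact: ae_sym.
- exact: ae_trans.
Qed.

Definition WOu_id (f : WOu_obj) : WOu_hom f f := class_of (at_id (valP f)).

Definition comp_class (f g h : WOu_obj) (B : WOu_hom g h) (A : WOu_hom f g) :
    set (prearrow G) :=
  [set w | exists v u, [/\ sval B v, sval A u
                         & arrow_eq alpha (val f) (val h) (v ∘ u)%arr w]].

Lemma comp_classE (f g h : WOu_obj) v u
    (hv : arrow_term alpha v (val g) (val h))
    (hu : arrow_term alpha u (val f) (val g)) :
  comp_class (class_of hv) (class_of hu) =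
  arrow_class (val f) (val h) (v ∘ u)%arr.
Proof.
apply/seteqP; split=> w /= => [[v' [u' [/= vv' uu' vuw]]]|vuw].
  by apply: ae_trans vuw; exact: ae_comp uu' vv'.
by exists v, u; split=> //=; exact: ae_refl.
Qed.

Lemma comp_classP (f g h : WOu_obj) (B : WOu_hom g h) (A : WOu_hom f g) :
  exists2 w, arrow_term alpha w (val f) (val h)
           & comp_class B A = arrow_class (val f) (val h) w.
Proof.
have [v [hv ->]] := WOu_homP B; have [u [hu ->]] := WOu_homP A.
exists (v ∘ u)%arr; [exact: at_comp hu hv | exact: comp_classE].
Qed.

Definition WOu_comp (f g h : WOu_obj) (B : WOu_hom g h) (A : WOu_hom f g) :
    WOu_hom f h :=
  exist _ (comp_class B A) (comp_classP B A).

Lemma WOu_compE (f g h : WOu_obj) v u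
    (hv : arrow_term alpha v (val g) (val h))
    (hu : arrow_term alpha u (val f) (val g)) :
  WOu_comp (class_of hv) (class_of hu) = class_of (at_comp hu hv).
Proof. by apply: WOu_hom_inj; exact: comp_classE. Qed.

Lemma WOu_comp1m (f g : WOu_obj) (A : WOu_hom f g) :
  WOu_comp (WOu_id g) A = A.
Proof.
have [u [hu ->]] := WOu_homP A; rewrite WOu_compE; apply: class_of_eq.
apply: ae_ax => //; first exact: ax_idl hu.
by apply: at_comp hu _; exact: at_id (valP g).
Qed.

Lemma WOu_compm1 (f g : WOu_obj) (A : WOu_hom f g) :
  WOu_comp A (WOu_id f) = A.
Proof.
have [u [hu ->]] := WOu_homP A; rewrite WOu_compE; apply: class_of_eq.
apply: ae_ax => //; first exact: ax_idr hu.
by apply: at_comp hu; exact: at_id (valP f).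
Qed.

Lemma WOu_compA (f g h j : WOu_obj)
    (C : WOu_hom h j) (B : WOu_hom g h) (A : WOu_hom f g) :
  WOu_comp (WOu_comp C B) A = WOu_comp C (WOu_comp B A).
Proof.
have [u [hu ->]] := WOu_homP A; have [v [hv ->]] := WOu_homP B.
have [w [hw ->]] := WOu_homP C; rewrite !WOu_compE; apply: class_of_eq.
apply: ae_ax; first exact: ax_assoc.
- exact: at_comp hu (at_comp hv hw).
- exact: at_comp (at_comp hu hv) hw.
Qed.

Definition WOu : category :=
  Category WOu_comp1m WOu_compm1 WOu_compA.

End WOu.

(* Main.v *)
From Corelib Require Import Setoid Morphisms.
From mathcomp Require Import all_boot finmap.
Require Import Defs.

Set Implicit Arguments.
Unset Strict Implicit.
Unset Printing Implicit Defensive.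

(** Every object is compared with a normal form, in the way coherence for
monoidal categories is proved by letting objects act on normal forms by
insertion.

A normal form is a left-nested term ((a.I ◁ x1) ◁ ... ) ◁ xk whose xi are
generators.  A term f acts on such a term m, when m ◁ f is a term, by a
term [act m f] and an arrow [act_arr m f] : m ◁ f -> act m f: a composite
g ◁ f acts by g and then by f, a unit acts trivially, and a generator is put
at the end and then slid to the left by thetas, past all generators whose
targets come later in a fixed total order of the words.  Because that order
extends the prefix order, a generator is never slid past one whose source
contains its target, so that all these thetas exist.

Each arrow u : f -> f' satisfies act m f = act m f' and
act_arr m f' ∘ (1_m ◁ u) = act_arr m f ([act_naturalP]).  On beta this is the
pentagon; on mu and lambda it is the unit equations, with the consequence
[mu_ins] of the pentagon.  On theta the two beta-theta equations and a double
induction over terms reduce it to two generators acting on m ([commP]), and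
there it is the hexagon, by induction on m ([slide_comm]).

Since all arrows are invertible, that equation determines 1_m ◁ u.  With m
the unit at the target of f, naturality of lambda then determines u, whence
any two arrows f -> f' are equal ([typed_aeq]). *)

(** * An order on words *)

(** Generators are sorted by this injective numbering of the words; the only
property of the encoding that matters is that it is monotone for prefixes. *)
Definition key (a : word) : nat := CodeSeq.code (map val a).

Lemma key_inj : injective key.
Proof.
by apply: inj_comp (can_inj CodeSeq.codeK) _; apply: inj_map; exact: val_inj.
Qed.

Lemma key_prefix a b : prefix a b -> key a <= key b.
Proof.
case/prefixP=> c ->; rewrite /key map_cat.
by elim: (map _ a) => //= n s IH; rewrite leq_mul2l ltnS leq_double IH orbT.
Qed.

(** * Sources and targets *)

Section Coherence.

Context (G : Type) (alpha : G -> nat).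

Local Notation term := (is_term alpha).
Local Notation s := (source alpha).
Local Notation t := (@target G).
Local Notation typed := (arrow_term alpha).
Local Open Scope prearrow_scope.

Implicit Types (f g h j m : preterm G) (u v w : prearrow G)
  (a b : word).

Lemma term_ins g f : term g -> term f -> t f \in s g -> term (g ◁ f)%trm.
Proof. by move=> /= -> -> ->. Qed.

Lemma term_insP g f :
  term (g ◁ f)%trm -> [/\ term g, term f & t f \in s g].
Proof. by case/and3P. Qed.

(** The members of a nominal arity are incomparable. *)
Lemma source_prefix_eq h g f : term h -> t g \in s h -> t f \in s h ->
  prefix (t g) (t f) -> t g = t f.
Proof.
move=> hh hg hf /prefixP[c E]; rewrite E.
have [na _] := source_arity hh.
by apply: na; rewrite -?E.
Qed.

Lemma target_prefix g f : term g -> t f \in s g -> prefix (t g) (t f).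
Proof. by move=> /source_arity[_]; exact. Qed.

Lemma term_beta h g f : term (h ◁ g)%trm -> term (g ◁ f)%trm ->
  term ((h ◁ g) ◁ f)%trm /\ term (h ◁ (g ◁ f))%trm.
Proof.
move=> /term_insP[hh hg hgi] /term_insP[_ hf hfi].
by rewrite /= hh hg hf hgi hfi /insw !inE hfi orbT.
Qed.

Lemma term_theta h g f : term (h ◁ g)%trm -> term (h ◁ f)%trm ->
  t g != t f -> term ((h ◁ g) ◁ f)%trm.
Proof.
move=> /term_insP[hh hg hgi] /term_insP[_ hf hfi] ne.
by rewrite /= hh hg hf hgi /insw !inE hfi eq_sym ne.
Qed.

Lemma source_beta h g f : term (h ◁ g)%trm -> term (g ◁ f)%trm ->
  s ((h ◁ g) ◁ f)%trm = s (h ◁ (g ◁ f))%trm.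
Proof.
move=> /term_insP[hh hg hgi] /term_insP[_ hf hfi] /=; rewrite /insw.
apply/fsetP=> b; rewrite !inE.
case: (b =P t f) => [->|_] /=; last by rewrite orbA.
have := source_prefix_eq hh hgi ^~ (target_prefix hg hfi).
by case: (t f \in s h) => [->|_] //; rewrite ?eqxx ?andbF ?orbA.
Qed.

Lemma target_notin_sibling h g f : term (h ◁ g)%trm -> term (h ◁ f)%trm ->
  t g != t f -> t f \notin s g.
Proof.
move=> /term_insP[hh hg hgi] /term_insP[_ hf hfi]; apply: contraNN => fg.
by rewrite (source_prefix_eq hh hgi hfi (target_prefix hg fg)).
Qed.

Lemma source_theta h g f : term (h ◁ g)%trm -> term (h ◁ f)%trm ->
  t g != t f -> s ((h ◁ g) ◁ f)%trm = s ((h ◁ f) ◁ g)%trm.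
Proof.
move=> hg hf ne.
have := target_notin_sibling hg hf ne; rewrite eq_sym in ne.
have := target_notin_sibling hf hg ne => /= gf fg.
apply/fsetP=> b; rewrite /insw !inE.
case: (b =P t f) => [->|_] /=; first by rewrite (negbTE fg) ne orbF.
case: (b =P t g) => [->|_] /=; last by rewrite orbAC.
by rewrite (negbTE gf) orbF.
Qed.

(** Hence an arrow can be inserted wherever its domain can, and its codomain
fits in the same place. *)
Lemma arrow_source_target u f g : typed u f g -> t f = t g /\ s f = s g.
Proof.
elim=> {u f g} //=.
- move=> h g f hh hg hf hgi hfi; split=> //.
  by apply: source_beta; apply: term_ins.
- move=> h g f hh hg hf hgi hfi; split=> //; symmetry.
  by apply: source_beta; apply: term_ins.
- move=> h g f hh hg hf hgi hfi ne; split=> //.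
  by apply: source_theta => //; apply: term_ins.
- by move=> f a hf ai; rewrite /insw fsetUC fsetD1K.
- by move=> f a hf ai; rewrite /insw fsetUC fsetD1K.
- move=> f hf; split=> //; rewrite /insw; apply/fsetP=> b; rewrite !inE.
  by case: (b == _).
- move=> f hf; split=> //; rewrite /insw; apply/fsetP=> b; rewrite !inE.
  by case: (b == _).
- by move=> u v f g h _ [-> ->] _ [-> ->].
- by move=> u v f f' g g' _ [-> ->] _ [-> ->].
Qed.

Lemma term_ins_arrow u v f f' g g' : typed u f f' -> typed v g g' ->
  term (g ◁ f)%trm -> term (g' ◁ f')%trm.
Proof.
move=> hu hv /term_insP[_ _ fg]; have [_ hf'] := arrow_termP hu.
have [_ hg'] := arrow_termP hv; apply: term_ins => //.
have [<- _] := arrow_source_target hu.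
by have [_ <-] := arrow_source_target hv.
Qed.

Lemma typed_comp_inv v u f h : typed (v ∘ u) f h ->
  exists2 g, typed u f g & typed v g h.
Proof. by move=> H; inversion H; subst; exists g. Qed.

Lemma typed_ins_inv v u x y : typed (v ◁ u) x y ->
  exists f f' g g', [/\ x = (g ◁ f)%trm, y = (g' ◁ f')%trm,
    typed u f f', typed v g g' & term (g ◁ f)%trm].
Proof. by move=> H; inversion H; subst; exists f, f', g, g'. Qed.

Lemma typed_uniq u f g f' g' :
  typed u f g -> typed u f' g' -> f = f' /\ g = g'.
Proof.
move=> hu; elim: hu f' g' => {u f g}.
1-8: move=> *; match goal with H : arrow_term _ _ _ _ |- _ =>
  by inversion H; subst end.
- move=> u v f g h _ IHu _ IHv f' h' /typed_comp_inv[g' hu hv].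
  by split; [case: (IHu _ _ hu)|case: (IHv _ _ hv)].
- move=> u v f f' g g' _ IHu _ IHv _ _ x y.
  case/typed_ins_inv=> [f1 [f2 [g1 [g2 [-> -> hu hv _]]]]].
  by have [-> ->] := IHu _ _ hu; have [-> ->] := IHv _ _ hv.
Qed.

(** The typing rules, with their side conditions gathered into terms. *)
Lemma typed_beta h g f : term (h ◁ g)%trm -> term (g ◁ f)%trm ->
  typed (Beta h g f) ((h ◁ g) ◁ f) (h ◁ (g ◁ f)).
Proof. by move=> /term_insP[? ? ?] /term_insP[? ? ?]; apply: at_beta. Qed.

Lemma typed_betaV h g f : term (h ◁ g)%trm -> term (g ◁ f)%trm ->
  typed (BetaInv h g f) (h ◁ (g ◁ f)) ((h ◁ g) ◁ f).
Proof. by move=> /term_insP[? ? ?] /term_insP[? ? ?]; apply: at_betaV. Qed.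

Lemma typed_theta h g f : term (h ◁ g)%trm -> term (h ◁ f)%trm -> t g != t f ->
  typed (Theta h g f) ((h ◁ g) ◁ f) ((h ◁ f) ◁ g).
Proof. by move=> /term_insP[? ? ?] /term_insP[? ? ?]; apply: at_theta. Qed.

Lemma typed_ins u v f f' g g' : typed u f f' -> typed v g g' ->
  term (g ◁ f)%trm -> typed (v ◁ u) (g ◁ f) (g' ◁ f').
Proof. by move=> hu hv h; exact: at_ins hu hv h (term_ins_arrow hu hv h). Qed.

(** * A congruence on all arrow expressions *)

(** Equality of arrow terms without mention of their type: if one side is well
typed then so is the other, with the same type, and they are equal there.
This makes sense for ill-typed expressions too, and is a congruence without
side conditions, so that it supports rewriting. *)
Variant aeq u v : Prop :=
  Aeq of (forall f g, typed u f g \/ typed v f g -> arrow_eq alpha f g u v).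

Local Notation "u ≈ v" := (aeq u v) (at level 70).

#[local] Instance aeq_equiv : Equivalence aeq.
Proof.
split.
- by move=> u; split=> f g [?|?]; apply: ae_refl.
- by move=> u v [uv]; split=> f g H; apply/ae_sym/uv; case: H; [right|left].
- move=> u v w [uv] [vw]; split=> f g [H|H].
    have uvfg := uv f g (or_introl H); have [_ hv] := arrow_eqP uvfg.
    exact: ae_trans uvfg (vw f g (or_introl hv)).
  have vwfg := vw f g (or_intror H); have [hv _] := arrow_eqP vwfg.
  exact: ae_trans (uv f g (or_intror hv)) vwfg.
Qed.

Lemma aeq_refl u : u ≈ u.
Proof. reflexivity. Qed.

#[local] Hint Resolve aeq_refl : core.

#[local] Instance aeq_comp : Proper (aeq ==> aeq ==> aeq) (@Comp G).
Proof.
move=> v v' [vv] u u' [uu]; split=> f h [] /typed_comp_inv[g hu hv].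
- by apply: ae_comp (uu _ _ (or_introl hu)) (vv _ _ (or_introl hv)).
- by apply: ae_comp (uu _ _ (or_intror hu)) (vv _ _ (or_intror hv)).
Qed.

#[local] Instance aeq_ins : Proper (aeq ==> aeq ==> aeq) (@ArrIns G).
Proof.
move=> v v' [vv] u u' [uu].
split=> x y [] /typed_ins_inv[f [f' [g [g' [-> -> hu hv H]]]]].
- have := term_ins_arrow hu hv H.
  by apply: ae_ins (uu _ _ (or_introl hu)) (vv _ _ (or_introl hv)) _.
- have := term_ins_arrow hu hv H.
  by apply: ae_ins (uu _ _ (or_intror hu)) (vv _ _ (or_intror hv)) _.
Qed.

Lemma aeqI u v f g : arrow_eq alpha f g u v -> u ≈ v.
Proof.
move=> uv; split=> f' g' H; have [hu hv] := arrow_eqP uv.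
by case: H => [/(typed_uniq hu)|/(typed_uniq hv)] [<- <-].
Qed.

Lemma aeq_ax u v f g :
  arrow_ax alpha u v -> typed u f g -> typed v f g -> u ≈ v.
Proof. by move=> uv hu hv; apply: aeqI; apply: ae_ax uv hu hv. Qed.

Lemma compA w v u : (w ∘ v) ∘ u ≈ w ∘ (v ∘ u).
Proof.
split=> f h H; apply: ae_ax; first exact: ax_assoc.
all: case: H => /typed_comp_inv[g].
1,3: by move=> hu /typed_comp_inv[g' hv hw]; do ?(eapply at_comp; eauto).
all: by case/typed_comp_inv=> g' hu hv hw; do ?(eapply at_comp; eauto).
Qed.

Lemma idr u f g : typed u f g -> u ∘ Id f ≈ u.
Proof.
move=> hu; have [hf _] := arrow_termP hu.
apply: (aeq_ax _ _ hu); first exact: ax_idr hu.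
by apply: at_comp hu; apply: at_id.
Qed.

Lemma idl u f g : typed u f g -> Id g ∘ u ≈ u.
Proof.
move=> hu; have [_ hg] := arrow_termP hu.
apply: (aeq_ax _ _ hu); first exact: ax_idl hu.
by apply: at_comp hu _; apply: at_id.
Qed.

Lemma ins_id g f : Id g ◁ Id f ≈ Id (g ◁ f).
Proof.
split=> x y H.
have {}H : [/\ term (g ◁ f)%trm, x = (g ◁ f)%trm & y = (g ◁ f)%trm].
  case: H => [/typed_ins_inv[f1 [f2 [g1 [g2 [-> -> hu hv]]]]]|H].
    by inversion hu; inversion hv; subst.
  by inversion H; subst.
case: H => H -> ->; apply: ae_ax; [exact: ax_ins_id| |exact: at_id].
by case/term_insP: (H) => ? ? ?; apply: typed_ins => //; exact: at_id.
Qed.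

Lemma ins_comp v2 v1 u2 u1 :
  (v2 ∘ v1) ◁ (u2 ∘ u1) ≈ (v2 ◁ u2) ∘ (v1 ◁ u1).
Proof.
split=> x y H.
suff [L R] : typed ((v2 ∘ v1) ◁ (u2 ∘ u1)) x y
    /\ typed ((v2 ◁ u2) ∘ (v1 ◁ u1)) x y.
  by apply: ae_ax => //; exact: ax_ins_comp.
case: H => H; split => //.
- case/typed_ins_inv: H => [f [f' [g [g' [-> -> hu hv H]]]]].
  have [f1 hu1 hu2] := typed_comp_inv hu.
  have [g1 hv1 hv2] := typed_comp_inv hv.
  have hu1v1 := typed_ins hu1 hv1 H.
  by apply: at_comp hu1v1 (typed_ins hu2 hv2 (term_ins_arrow hu1 hv1 H)).
- case/typed_comp_inv: H => z /typed_ins_inv[f [f' [g [g' [-> -> hu hv H]]]]].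
  case/typed_ins_inv=> [f1 [f2 [g1 [g2 [[? ?] -> hu2 hv2 H2]]]]]; subst.
  by apply: typed_ins (at_comp hu hu2) (at_comp hv hv2) H.
Qed.

(** * The equations as rewriting rules *)

Ltac split_hyps := repeat match goal with
  | H : is_true (_ && _) |- _ =>
      let H1 := fresh in let H2 := fresh in move/andP: H => [H1 H2]
  end.

(** Proves that an insertion is a term from hypotheses of the same kind and
from the distinctness of targets. *)
Ltac auto_term :=
  simpl in *; rewrite /insw ?inE; split_hyps;
  repeat match goal with
  | H : is_true (?x != ?y) |- _ => rewrite ?H ?(eq_sym y x) ?H; clear H
  | H : is_true _ |- _ => rewrite ?H; clear H
  end; rewrite ?eqxx ?orbT ?andbT //=.

Ltac auto_typed := repeat first
  [ eassumption | apply: at_id; solve [auto_term]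
  | apply: typed_beta; solve [auto_term] | apply: typed_betaV; solve [auto_term]
  | apply: typed_theta; solve [auto_term]
  | apply: at_mu; solve [auto_term] | apply: at_muV; solve [auto_term]
  | apply: at_lam; solve [auto_term] | apply: at_lamV; solve [auto_term]
  | match goal with |- is_true _ => solve [auto_term] end
  | eapply typed_ins
  | eapply at_comp ].

(** The right-hand side is typed first: in the naturality equations it starts
with a basic arrow, which fixes the common domain of both sides. *)
Tactic Notation "by_axiom" uconstr(ax) :=
  eapply aeq_ax; [eapply ax| |auto_typed]; auto_typed.

Lemma betaK h g f : term (h ◁ g)%trm -> term (g ◁ f)%trm ->
  BetaInv h g f ∘ Beta h g f ≈ Id ((h ◁ g) ◁ f).
Proof. move=> H1 H2; by_axiom ax_betaK. Qed.

Lemma betaVK h g f : term (h ◁ g)%trm -> term (g ◁ f)%trm ->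
  Beta h g f ∘ BetaInv h g f ≈ Id (h ◁ (g ◁ f)).
Proof. move=> H1 H2; by_axiom ax_betaVK. Qed.

Lemma beta_nat u v w f1 f2 g1 g2 h1 h2 :
  typed u f1 f2 -> typed v g1 g2 -> typed w h1 h2 ->
  term (h1 ◁ g1)%trm -> term (g1 ◁ f1)%trm ->
  Beta h2 g2 f2 ∘ ((w ◁ v) ◁ u) ≈ (w ◁ (v ◁ u)) ∘ Beta h1 g1 f1.
Proof.
move=> hu hv hw H1 H2.
have H1' := term_ins_arrow hv hw H1; have H2' := term_ins_arrow hu hv H2.
by_axiom (ax_beta_nat hu hv hw).
Qed.

Lemma theta_nat u v w f1 f2 g1 g2 h1 h2 :
  typed u f1 f2 -> typed v g1 g2 -> typed w h1 h2 ->
  term (h1 ◁ g1)%trm -> term (h1 ◁ f1)%trm -> t g1 != t f1 ->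
  Theta h2 g2 f2 ∘ ((w ◁ v) ◁ u) ≈ ((w ◁ u) ◁ v) ∘ Theta h1 g1 f1.
Proof.
move=> hu hv hw H1 H2 ne.
have H1' := term_ins_arrow hv hw H1; have H2' := term_ins_arrow hu hw H2.
have ne' : t g2 != t f2.
  have [<- _] := arrow_source_target hu.
  by have [<- _] := arrow_source_target hv.
by_axiom (ax_theta_nat hu hv hw).
Qed.

Lemma thetaK h g f : term (h ◁ g)%trm -> term (h ◁ f)%trm -> t g != t f ->
  Theta h f g ∘ Theta h g f ≈ Id ((h ◁ g) ◁ f).
Proof.
move=> H1 H2 ne; have ne' : t f != t g by rewrite eq_sym.
by_axiom ax_thetaK.
Qed.

Lemma pentagon j h g f :
  term (j ◁ h)%trm -> term (h ◁ g)%trm -> term (g ◁ f)%trm ->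
  (Id j ◁ Beta h g f) ∘ Beta j (h ◁ g) f ∘ (Beta j h g ◁ Id f) ≈
  Beta j h (g ◁ f) ∘ Beta (j ◁ h) g f.
Proof. move=> H1 H2 H3; by_axiom ax_beta_pentagon. Qed.

Lemma hexagon j h g f :
  term (j ◁ h)%trm -> term (j ◁ g)%trm -> term (j ◁ f)%trm ->
  t h != t g -> t h != t f -> t g != t f ->
  Theta (j ◁ f) h g ∘ (Theta j h f ◁ Id g) ∘ Theta (j ◁ h) g f ≈
  (Theta j g f ◁ Id h) ∘ Theta (j ◁ g) h f ∘ (Theta j h g ◁ Id f).
Proof.
move=> H1 H2 H3 hg hf gf; by_axiom ax_theta_hexagon.
Qed.

Lemma beta_theta1 j h g f :
  term (j ◁ h)%trm -> term (h ◁ g)%trm -> term (h ◁ f)%trm -> t g != t f ->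
  (Id j ◁ Theta h g f) ∘ Beta j (h ◁ g) f ∘ (Beta j h g ◁ Id f) ≈
  Beta j (h ◁ f) g ∘ (Beta j h f ◁ Id g) ∘ Theta (j ◁ h) g f.
Proof.
move=> H1 H2 H3 gf; by_axiom ax_beta_theta1.
Qed.

Lemma beta_theta2 j h g f :
  term (j ◁ h)%trm -> term (h ◁ g)%trm -> term (j ◁ f)%trm ->
  t h != t f -> t g != t f ->
  Theta j (h ◁ g) f ∘ (Beta j h g ◁ Id f) ≈
  Beta (j ◁ f) h g ∘ (Theta j h f ◁ Id g) ∘ Theta (j ◁ h) g f.
Proof.
move=> H1 H2 H3 hf gf; by_axiom ax_beta_theta2.
Qed.

Lemma mu_nat u f1 f2 a : typed u f1 f2 -> a \in s f1 ->
  Mu f2 a ∘ (u ◁ Id (Unit a)) ≈ u ∘ Mu f1 a.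
Proof.
move=> hu af; have [H1 H2] := arrow_termP hu.
have af2 : a \in s f2 by have [_ <-] := arrow_source_target hu.
by_axiom (ax_mu_nat a hu).
Qed.

Lemma lam_nat u f1 f2 : typed u f1 f2 ->
  Lam f2 ∘ (Id (Unit (t f1)) ◁ u) ≈ u ∘ Lam f1.
Proof.
move=> hu; have [H1 H2] := arrow_termP hu.
have [E _] := arrow_source_target hu.
have hl : typed (Lam f2) (Unit (t f1) ◁ f2) f2 by rewrite E; apply: at_lam.
eapply aeq_ax; [exact: ax_lam_nat hu| |auto_typed].
by apply: at_comp hl; apply: typed_ins hu _ _; [auto_typed|auto_term].
Qed.

Lemma muK f a : term f -> a \in s f -> MuInv f a ∘ Mu f a ≈ Id (f ◁ Unit a).
Proof. move=> H af; by_axiom ax_muK. Qed.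

Lemma muVK f a : term f -> a \in s f -> Mu f a ∘ MuInv f a ≈ Id f.
Proof. move=> H af; by_axiom ax_muVK. Qed.

Lemma lamK f : term f -> LamInv f ∘ Lam f ≈ Id (Unit (t f) ◁ f).
Proof. move=> H; by_axiom ax_lamK. Qed.

Lemma lamVK f : term f -> Lam f ∘ LamInv f ≈ Id f.
Proof. move=> H; by_axiom ax_lamVK. Qed.

Lemma beta_unit h f : term (h ◁ f)%trm ->
  Beta h (Unit (t f)) f ≈ (Id h ◁ LamInv f) ∘ (Mu h (t f) ◁ Id f).
Proof. move=> H; by_axiom ax_beta_unit. Qed.

Lemma theta_unit h b f : term (h ◁ f)%trm -> b \in s h -> b != t f ->
  Theta h (Unit b) f ≈ MuInv (h ◁ f) b ∘ (Mu h b ◁ Id f).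
Proof. move=> H bh bf; by_axiom ax_theta_unit. Qed.

(** * Derived rules *)

Lemma comp_id f : Id f ∘ Id f ≈ Id f.
Proof.
suff H x y : typed (Id f ∘ Id f) x y \/ typed (Id f) x y -> term f.
  by split=> x y H'; have [E] := idl (at_id (H x y H')); exact: E.
by case=> [/typed_comp_inv[z H _]|H]; inversion H; subst.
Qed.

Lemma insl_comp v u f : (v ∘ u) ◁ Id f ≈ (v ◁ Id f) ∘ (u ◁ Id f).
Proof. by rewrite -ins_comp comp_id. Qed.

Lemma insr_comp v u g : Id g ◁ (v ∘ u) ≈ (Id g ◁ v) ∘ (Id g ◁ u).
Proof. by rewrite -ins_comp comp_id. Qed.

(** With composites nested to the right, a rule u ∘ v = w is applied inside a
longer composite in this form. *)
Lemma compL u v w x : u ∘ v ≈ w -> u ∘ (v ∘ x) ≈ w ∘ x.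
Proof. by move=> <-; rewrite compA. Qed.

Lemma insl_compL v u f x :
  (v ◁ Id f) ∘ ((u ◁ Id f) ∘ x) ≈ ((v ∘ u) ◁ Id f) ∘ x.
Proof. by rewrite -compA -insl_comp. Qed.

Lemma cancelL u' u x f g : u' ∘ u ≈ Id g -> typed x f g ->
  u' ∘ (u ∘ x) ≈ x.
Proof. by move=> E hx; rewrite (compL _ E) (idl hx). Qed.

Lemma moveR u v w w' f g : w ∘ w' ≈ Id f -> typed u f g ->
  u ∘ w ≈ v -> u ≈ v ∘ w'.
Proof. by move=> E hu <-; rewrite compA E (idr hu). Qed.

Lemma insl_inv v v' g f : v' ∘ v ≈ Id g ->
  (v' ◁ Id f) ∘ (v ◁ Id f) ≈ Id (g ◁ f).
Proof. by move=> E; rewrite -insl_comp E ins_id. Qed.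

Lemma insr_inv v v' g f : v' ∘ v ≈ Id g ->
  (Id f ◁ v') ∘ (Id f ◁ v) ≈ Id (f ◁ g).
Proof. by move=> E; rewrite -insr_comp E ins_id. Qed.

Lemma arrow_inv u f g : typed u f g ->
  exists v, [/\ typed v g f, v ∘ u ≈ Id f & u ∘ v ≈ Id g].
Proof.
elim=> {u f g}.
- by move=> f hf; exists (Id f); split; rewrite ?comp_id //; exact: at_id.
- move=> h g f hh hg hf gh fg; have H1 := term_ins hh hg gh.
  have H2 := term_ins hg hf fg.
  by exists (BetaInv h g f); split; [auto_typed|exact: betaK|exact: betaVK].
- move=> h g f hh hg hf gh fg; have H1 := term_ins hh hg gh.
  have H2 := term_ins hg hf fg.
  by exists (Beta h g f); split; [auto_typed|exact: betaVK|exact: betaK].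
- move=> h g f hh hg hf gh fh ne; have H1 := term_ins hh hg gh.
  have H2 := term_ins hh hf fh; have ne' : t f != t g by rewrite eq_sym.
  by exists (Theta h f g); split; [auto_typed|exact: thetaK|exact: thetaK].
- move=> f a hf af; exists (MuInv f a).
  by split; [auto_typed|exact: muK|exact: muVK].
- move=> f a hf af; exists (Mu f a).
  by split; [auto_typed|exact: muVK|exact: muK].
- move=> f hf; exists (LamInv f).
  by split; [auto_typed|exact: lamK|exact: lamVK].
- by move=> f hf; exists (Lam f); split; [auto_typed|exact: lamVK|exact: lamK].
- move=> u v f g h hu [u' [hu' uK uVK]] hv [v' [hv' vK vVK]].
  exists (u' ∘ v'); split; first exact: at_comp hu'.
    by rewrite compA (cancelL vK hu).
  by rewrite compA (cancelL uVK hv').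
- move=> u v f f' g g' hu [u' [hu' uK uVK]] hv [v' [hv' vK vVK]] H1 H2.
  exists (v' ◁ u'); split; first exact: at_ins.
    by rewrite -ins_comp uK vK ins_id.
  by rewrite -ins_comp uVK vVK ins_id.
Qed.

Lemma arrow_epi w f g u v h h' : typed w f g -> typed u g h -> typed v g h' ->
  u ∘ w ≈ v ∘ w -> u ≈ v.
Proof.
move=> /arrow_inv[w' [_ _ wK]] hu hv E.
by rewrite (moveR wK hu E) compA wK (idr hv).
Qed.

Lemma arrow_mono w f g u v h h' : typed w f g -> typed u h f -> typed v h' f ->
  w ∘ u ≈ w ∘ v -> u ≈ v.
Proof.
move=> /arrow_inv[w' [_ wK _]] hu hv E.
by rewrite -(cancelL wK hu) E (cancelL wK hv).
Qed.

Lemma betaV_nat u v w f1 f2 g1 g2 h1 h2 :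
  typed u f1 f2 -> typed v g1 g2 -> typed w h1 h2 ->
  term (h1 ◁ g1)%trm -> term (g1 ◁ f1)%trm ->
  BetaInv h2 g2 f2 ∘ (w ◁ (v ◁ u)) ≈ ((w ◁ v) ◁ u) ∘ BetaInv h1 g1 f1.
Proof.
move=> hu hv hw H1 H2.
have H1' := term_ins_arrow hv hw H1; have H2' := term_ins_arrow hu hv H2.
apply: moveR (betaVK H1 H2) _ _; first by auto_typed.
rewrite compA -(beta_nat hu hv hw) //.
by apply: cancelL (betaK H1' H2') _; auto_typed.
Qed.

(** This and the next two rules are the pentagon and the two beta-theta
equations, with the betas moved to the other side: [act_arr] is built from
inverses of beta. *)
Lemma pentagonV j h g f :
  term (j ◁ h)%trm -> term (h ◁ g)%trm -> term (g ◁ f)%trm ->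
  BetaInv (j ◁ h) g f ∘ (BetaInv j h (g ◁ f) ∘ (Id j ◁ Beta h g f)) ≈
  (BetaInv j h g ◁ Id f) ∘ BetaInv j (h ◁ g) f.
Proof.
move=> H1 H2 H3.
have K1 : Beta j (h ◁ g) f ∘ BetaInv j (h ◁ g) f ≈ Id (j ◁ ((h ◁ g) ◁ f)).
  by apply: betaVK; auto_term.
have K2 := insl_inv f (betaVK H1 H2).
have K3 : BetaInv j h (g ◁ f) ∘ Beta j h (g ◁ f) ≈ Id ((j ◁ h) ◁ (g ◁ f)).
  by apply: betaK; auto_term.
have K4 : BetaInv (j ◁ h) g f ∘ Beta (j ◁ h) g f ≈ Id (((j ◁ h) ◁ g) ◁ f).
  by apply: betaK; auto_term.
rewrite -[X in X ≈ _]compA.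
apply: moveR K1 _ _; first by auto_typed.
have K5 : typed (BetaInv j h g ◁ Id f)
    ((j ◁ (h ◁ g)) ◁ f) (((j ◁ h) ◁ g) ◁ f) by auto_typed.
rewrite -[X in _ ≈ X](idl K5).
apply: moveR K2 _ _; first by auto_typed.
by rewrite !compA -(compA (_ ◁ _)) pentagon // (compL _ K3) idl; [|auto_typed].
Qed.

Lemma beta_theta1V j h g f :
  term (j ◁ h)%trm -> term (h ◁ g)%trm -> term (h ◁ f)%trm -> t g != t f ->
  (BetaInv j h f ◁ Id g) ∘ (BetaInv j (h ◁ f) g ∘ (Id j ◁ Theta h g f)) ≈
  Theta (j ◁ h) g f ∘ ((BetaInv j h g ◁ Id f) ∘ BetaInv j (h ◁ g) f).
Proof.
move=> H1 H2 H3 gf.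
have K1 : Beta j (h ◁ g) f ∘ BetaInv j (h ◁ g) f ≈ Id (j ◁ ((h ◁ g) ◁ f)).
  by apply: betaVK; auto_term.
have K2 := insl_inv f (betaVK H1 H2).
have K3 : BetaInv j (h ◁ f) g ∘ Beta j (h ◁ f) g ≈ Id ((j ◁ (h ◁ f)) ◁ g).
  by apply: betaK; auto_term.
have K4 := insl_inv g (betaK H1 H3).
rewrite -!compA.
apply: moveR K1 _ _; first by auto_typed.
apply: moveR K2 _ _; first by auto_typed.
rewrite !compA -(compA (Id j ◁ _)) beta_theta1 //.
rewrite !compA (compL _ K3) idl; last by auto_typed.
by apply: cancelL K4 _; auto_typed.
Qed.

Lemma beta_theta2V j h g f :
  term (j ◁ h)%trm -> term (h ◁ g)%trm -> term (j ◁ f)%trm ->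
  t h != t f -> t g != t f ->
  BetaInv (j ◁ f) h g ∘ Theta j (h ◁ g) f ≈
  (Theta j h f ◁ Id g) ∘ (Theta (j ◁ h) g f ∘ (BetaInv j h g ◁ Id f)).
Proof.
move=> H1 H2 H3 hf gf.
have K1 := insl_inv f (betaVK H1 H2).
have K2 : BetaInv (j ◁ f) h g ∘ Beta (j ◁ f) h g ≈ Id (((j ◁ f) ◁ h) ◁ g).
  by apply: betaK; auto_term.
rewrite -!compA; apply: moveR K1 _ _; first by auto_typed.
by rewrite !compA beta_theta2 // compA; apply: cancelL K2 _; auto_typed.
Qed.

(** By naturality of mu, inserting a unit is isomorphic to the identity
functor. *)
Lemma unit_faithful u v f g a : typed u f g -> typed v f g -> a \in s f ->
  u ◁ Id (Unit a) ≈ v ◁ Id (Unit a) -> u ≈ v.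
Proof.
move=> hu hv af E; have [hf hg] := arrow_termP hu.
have hmu : typed (Mu f a) (f ◁ Unit a) f by exact: at_mu.
apply: (arrow_epi hmu hu hv).
by rewrite -(mu_nat hu af) -(mu_nat hv af) E.
Qed.

(** The analogue of Kelly's theorem that the right unit of a tensor product is
determined by that of its second factor. *)
Lemma mu_ins m f a : term (m ◁ f)%trm -> a \in s f ->
  (Id m ◁ Mu f a) ∘ Beta m f (Unit a) ≈ Mu (m ◁ f) a.
Proof.
move=> H af.
have H1 : term (f ◁ Unit a)%trm by auto_term.
have hmu : typed (Mu f a) (f ◁ Unit a) f by auto_typed.
(* Both sides become equal once inserted along a unit, which loses nothing. *)
apply: (@unit_faithful _ _ ((m ◁ f) ◁ Unit a) (m ◁ f) a);
  [auto_typed|auto_typed|auto_term|].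
have hI : term (Unit a ◁ Unit a : preterm G)%trm by auto_term.
have hm : typed (Id m) m m by auto_typed.
have hf : typed (Id f) f f by auto_typed.
have hlam : typed (LamInv (Unit a)) (Unit a) (Unit a ◁ Unit a : preterm G).
  by apply: (at_lamV (f := Unit a)).
have hu : typed (Id (Unit a)) (Unit a) (Unit a : preterm G) by auto_typed.
have N1 := beta_nat hlam hf hm H H1.
have N2 : (Id m ◁ (Mu f a ◁ Id (Unit a))) ∘ Beta m (f ◁ Unit a) (Unit a) ≈
    Beta m f (Unit a) ∘ ((Id m ◁ Mu f a) ◁ Id (Unit a)).
  by rewrite (beta_nat hu hmu hm) //; auto_term.
(* In the pentagon for m, f and two units, expand both associators of a unit. *)
have := pentagon H H1 hI.
have -> : Beta f (Unit a) (Unit a) ≈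
    (Id f ◁ LamInv (Unit a)) ∘ (Mu f a ◁ Id (Unit a)).
  exact: (beta_unit (f := Unit a) H1).
have -> : Beta (m ◁ f) (Unit a) (Unit a) ≈
    (Id (m ◁ f) ◁ LamInv (Unit a)) ∘ (Mu (m ◁ f) a ◁ Id (Unit a)).
  by apply: (beta_unit (f := Unit a)); auto_term.
rewrite -(ins_id m f) insr_comp !compA (compL _ N2) (compL _ N1) !compA.
rewrite -insl_comp => E.
(* Both sides now end with the same two isomorphisms. *)
have {}E := arrow_mono (w := Id m ◁ (Id f ◁ LamInv (Unit a))) _ _ _ E.
have {}E := arrow_mono (w := Beta m f (Unit a)) _ _ _ (E _ _ _ _ _ _ _).
apply: E; auto_typed.
Qed.

(** * Action of terms on normal forms *)

(** One step of insertion sort: m is read as the list of its right factors, and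
y stops at the first factor from the right whose target is not larger.  A factor
with the same target as y is an ancestor of y, so that y must not pass it. *)
Fixpoint slide m y : preterm G :=
  match m with
  | Ins m' z =>
      if key (t y) < key (t z) then (slide m' y ◁ z)%trm else (m ◁ y)%trm
  | _ => (m ◁ y)%trm
  end.

Fixpoint slide_arr m y : prearrow G :=
  match m with
  | Ins m' z =>
      if key (t y) < key (t z) then (slide_arr m' y ◁ Id z) ∘ Theta m' z y
      else Id (m ◁ y)
  | _ => Id (m ◁ y)
  end.

Fixpoint act m f : preterm G :=
  match f with
  | Gen _ _ => slide m f
  | Unit _ => m
  | Ins g f => act (act m g) f
  end.

Fixpoint act_arr m f : prearrow G :=
  match f with
  | Gen _ _ => slide_arr m f
  | Unit a => Mu m a
  | Ins g f => act_arr (act m g) f ∘ ((act_arr m g ◁ Id f) ∘ BetaInv m g f)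
  end.

Lemma key_lt_target y z : key (t y) < key (t z) -> t z != t y.
Proof. by apply: contraTneq => ->; rewrite ltnn. Qed.

(** If z had the target of y in its source, then the target of z would be a
prefix of that of y and could not have a larger key. *)
Lemma key_lt_term m y z : term ((m ◁ z) ◁ y)%trm ->
  key (t y) < key (t z) -> term (m ◁ y)%trm.
Proof.
move=> /term_insP[/term_insP[hm hz zm] hy /=]; rewrite /insw !inE.
case/orP=> [/andP[_ ym] _|yz]; first by auto_term.
by rewrite ltnNge (key_prefix (target_prefix hz yz)).
Qed.

Lemma term_insl g f : term (g ◁ f)%trm -> term g.
Proof. by case/term_insP. Qed.

Lemma term_insr g f : term (g ◁ f)%trm -> term f.
Proof. by case/term_insP. Qed.

Lemma typed_idins u f g g' : typed u g g' -> term (g ◁ f)%trm ->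
  typed (u ◁ Id f) (g ◁ f) (g' ◁ f).
Proof. by move=> hu H; exact: typed_ins (at_id (term_insr H)) hu H. Qed.

Lemma slide_arrP m y : term (m ◁ y)%trm ->
  typed (slide_arr m y) (m ◁ y) (slide m y).
Proof.
elim: m => [a x|a|m IHm z _] H; [exact: at_id..|].
rewrite [slide_arr _ _]/= [slide _ _]/=; case: ifP => [lt|_]; last exact: at_id.
have my := key_lt_term H lt; have mz := term_insl H.
have ne := key_lt_target lt; have ne' : t y != t z by rewrite eq_sym.
apply: at_comp (typed_theta mz my ne) _.
exact: typed_idins (IHm my) (term_theta my mz ne').
Qed.

Lemma act_arrP m f : term (m ◁ f)%trm -> typed (act_arr m f) (m ◁ f) (act m f).
Proof.
elim: f m => [a x|a|g IHg f IHf] m H; first exact: slide_arrP.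
  by apply: at_mu; auto_term.
have gf := term_insr H.
have mg : term (m ◁ g)%trm by auto_term.
have mgf := (term_beta mg gf).1.
have hf := at_id (term_insr gf).
apply: at_comp (IHf _ (term_ins_arrow hf (IHg _ mg) mgf)).
exact: at_comp (typed_betaV mg gf) (typed_idins (IHg _ mg) mgf).
Qed.

Lemma term_act m g f : term (m ◁ g)%trm -> term ((m ◁ g) ◁ f)%trm ->
  term (act m g ◁ f)%trm.
Proof.
move=> mg mgf.
exact: term_ins_arrow (at_id (term_insr mgf)) (act_arrP mg) mgf.
Qed.

(** * Interchange of two actions *)

(** The two ways of letting g and f act at distinct places agree, up to the
theta that exchanges them. *)
Definition comm g f := forall m,
  term (m ◁ g)%trm -> term (m ◁ f)%trm -> t g != t f ->
  act (act m g) f = act (act m f) g /\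
  act_arr (act m g) f ∘ (act_arr m g ◁ Id f) ≈
    act_arr (act m f) g ∘ ((act_arr m f ◁ Id g) ∘ Theta m g f).

(** The theta in the statement is inverted by the one with g and f exchanged. *)
Lemma comm_sym g f : comm g f -> comm f g.
Proof.
move=> C m mf mg ne; have ne' : t g != t f by rewrite eq_sym.
have [E1 E2] := C m mg mf ne'; split=> //.
have hmf := typed_idins (act_arrP mf) (term_theta mf mg ne).
by rewrite -[X in _ ≈ X]compA E2 !compA (thetaK mf mg ne) (idr hmf).
Qed.

(** A unit equation expresses this theta by mu and the inverse of mu. *)
Lemma comm_unit b f : comm (Unit b) f.
Proof.
move=> m mb mf ne; split=> //.
have hmb : b \in s m by case/term_insP: mb.
have hb : b \in s (m ◁ f)%trm by auto_term.
rewrite -[X in _ ≈ X]compA [act m _]/= [act_arr _ (Unit b)]/=.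
rewrite (mu_nat (act_arrP mf) hb).
rewrite (theta_unit mf hmb ne) !compA [act_arr m _]/=.
rewrite (cancelL (muVK mf hb)) //.
by apply: typed_idins; [apply: at_mu; auto_term|exact: term_theta].
Qed.

(** By the second beta-theta equation, exchanging f with g1 ◁ g2 is exchanging
it with g2 and then with g1. *)
Lemma comm_ins g1 g2 f : comm g1 f -> comm g2 f -> comm (g1 ◁ g2)%trm f.
Proof.
move=> C1 C2 m mg mf ne; rewrite /= in ne.
have gg := term_insr mg.
have mg1 : term (m ◁ g1)%trm by auto_term.
have [E1 D1] := C1 m mg1 mf ne.
have mgg := (term_beta mg1 gg).1.
have ne2 : t g2 != t f.
  apply/eqP=> E; case/term_insP: gg => h1 h2; rewrite E => p.
  have := target_prefix h1 p; case/term_insP: mg1 => hm _ g1m.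
  case/term_insP: mf => _ _ fm /(source_prefix_eq hm g1m fm) E'.
  by rewrite E' eqxx in ne.
have mg1f := term_theta mg1 mf ne.
have m1g2 := term_act mg1 mgg.
have m1f := term_act mg1 mg1f.
have [E2 D2] := C2 _ m1g2 m1f ne2.
split; first by rewrite /= E2 E1.
rewrite [act m _]/= [act_arr m (_ ◁ _)%trm]/= !insl_comp -!compA D2 E1.
rewrite [act_arr _ (_ ◁ _)%trm]/= !compA.
have hf := at_id (term_insr mf).
have hg1 := at_id (term_insr mg1); have hg2 := at_id (term_insr gg).
rewrite (compL _ (theta_nat hf hg2 (act_arrP mg1) mgg mg1f ne2)) compA.
rewrite insl_compL D1 -E1 !insl_comp !compA.
have mfg1 : term ((m ◁ f) ◁ g1)%trm by apply: term_theta; rewrite // eq_sym.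
rewrite -(ins_id g1 g2) (compL _ (betaV_nat hg2 hg1 (act_arrP mf) mfg1 gg)).
by rewrite !compA (beta_theta2V mg1 gg mf ne ne2).
Qed.

(** The condition for y to be added at the end of m. *)
Definition stays m y :=
  if m is Ins _ z then key (t z) <= key (t y) else true.

Lemma slide_stays m y : stays m y ->
  slide m y = (m ◁ y)%trm /\ slide_arr m y = Id (m ◁ y).
Proof. by case: m => //= m z; rewrite ltnNge => ->. Qed.

Lemma stays_slide m x y : key (t x) < key (t y) -> stays m y ->
  stays (slide m x) y.
Proof.
move=> lt; case: m => [a z|a|m z] /= st; [exact: ltnW..|].
by case: ifP => //= _; exact: ltnW.
Qed.

Lemma slide_lt m x y : key (t x) < key (t y) ->
  slide (m ◁ y)%trm x = (slide m x ◁ y)%trm /\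
  slide_arr (m ◁ y)%trm x = (slide_arr m x ◁ Id y) ∘ Theta m y x.
Proof. by move=> /= ->. Qed.

(** The order of the keys is assumed since the statement is symmetric in x and
y, which [comm_sym] exploits. *)
Lemma slide_comm m x y : key (t x) < key (t y) ->
  term (m ◁ x)%trm -> term (m ◁ y)%trm ->
  slide (slide m x) y = slide (slide m y) x /\
  slide_arr (slide m x) y ∘ (slide_arr m x ◁ Id y) ≈
    slide_arr (slide m y) x ∘ ((slide_arr m y ◁ Id x) ∘ Theta m x y).
Proof.
move=> lt; have ne := key_lt_target lt.
have ne' : t x != t y by rewrite eq_sym.
(* If y stays at the end, only the arrow of x moves anything, and the theta
   that it starts with cancels the theta of the statement. *)
have case_stays m' : stays m' y -> term (m' ◁ x)%trm -> term (m' ◁ y)%trm ->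
    slide (slide m' x) y = slide (slide m' y) x /\
    slide_arr (slide m' x) y ∘ (slide_arr m' x ◁ Id y) ≈
      slide_arr (slide m' y) x ∘ ((slide_arr m' y ◁ Id x) ∘ Theta m' x y).
  move=> st mx my; have [-> ->] := slide_stays st.
  have [-> ->] := slide_stays (stays_slide lt st).
  have [-> ->] := slide_lt m' lt; split=> //.
  have hx := typed_idins (slide_arrP mx) (term_theta mx my ne').
  rewrite (idl hx) ins_id (idl (typed_theta mx my ne')) compA.
  by rewrite (thetaK mx my ne') (idr hx).
elim: m => [a z|a|m IHm z _] mx my; [exact: case_stays..|].
case: (leqP (key (t z)) (key (t y))) => [zy|yz].
  exact: (case_stays (m ◁ z)%trm).
(* Both x and y slide past z: naturality of theta on either side brings the
   two composites to the two sides of the hexagon for z, x and y. *)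
have xz := ltn_trans lt yz.
have mx' := key_lt_term mx xz; have my' := key_lt_term my yz.
have mz := term_insl mx.
have [E D] := IHm mx' my'.
have [-> ->] := slide_lt m xz; have [-> ->] := slide_lt m yz.
have [-> ->] := slide_lt (slide m x) yz.
have [-> ->] := slide_lt (slide m y) xz.
split; first by rewrite E.
have nez := key_lt_target xz; have nezy := key_lt_target yz.
have hx := at_id (term_insr mx); have hy := at_id (term_insr my).
have hz := at_id (term_insr mz).
have mxz : term ((m ◁ x) ◁ z)%trm by apply: term_theta; rewrite // eq_sym.
have myz : term ((m ◁ y) ◁ z)%trm by apply: term_theta; rewrite // eq_sym.
have mxy := term_theta mx' my' ne'; have myx := term_theta my' mx' ne.
rewrite !insl_comp !compA.
rewrite (compL _ (theta_nat hy hz (slide_arrP mx') mxz mxy nezy)).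
rewrite (compL _ (theta_nat hx hz (slide_arrP my') myz myx nez)).
have := hexagon mz mx' my' nez nezy ne'; rewrite !compA => ->.
by rewrite !insl_compL D !insl_comp !compA.
Qed.

Lemma comm_gen a x b y : comm (Gen a x) (Gen b y).
Proof.
have lt_comm c z d z' : key c < key d -> comm (Gen c z) (Gen d z').
  by move=> lt m mx my _; exact: slide_comm.
case: (ltngtP (key a) (key b)) => [|ba|/key_inj <-]; first exact: lt_comm.
  exact/comm_sym/lt_comm.
by move=> m _ _; rewrite eqxx.
Qed.

Lemma commP g f : comm g f.
Proof.
elim: g => [a x|a|g1 IH1 g2 IH2]; [|exact: comm_unit|exact: comm_ins].
elim: f => [b y|b|f1 IH1 f2 IH2]; first exact: comm_gen.
  exact/comm_sym/comm_unit.
by apply/comm_sym/comm_ins; exact: comm_sym.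
Qed.

(** * Naturality of the action and coherence *)

(** For fixed m, [act_arr m] is a natural transformation from the functor of
insertion into m to a functor that sends all arrows to identities. *)
Definition act_natural u f f' := forall m, term (m ◁ f)%trm ->
  act m f = act m f' /\ act_arr m f' ∘ (Id m ◁ u) ≈ act_arr m f.

Lemma act_natural_inv u v f g : typed u f g -> typed v g f -> u ∘ v ≈ Id g ->
  act_natural u f g -> act_natural v g f.
Proof.
move=> hu hv uvK nat_u m mg; have hm := at_id (term_insl mg).
have [E D] := nat_u m (term_ins_arrow hv hm mg); split=> //.
by rewrite -D compA -insr_comp uvK ins_id (idr (act_arrP mg)).
Qed.

Lemma act_natural_beta h g f : term (h ◁ g)%trm -> term (g ◁ f)%trm ->
  act_natural (Beta h g f) ((h ◁ g) ◁ f) (h ◁ (g ◁ f)).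
Proof.
move=> hg gf m H; split=> //=.
have mh : term (m ◁ h)%trm by auto_term.
have idg := at_id (term_insr hg); have idf := at_id (term_insr gf).
have mhg := (term_beta mh hg).1.
rewrite !compA -(ins_id g f).
rewrite (compL _ (betaV_nat idf idg (act_arrP mh) mhg gf)) !compA.
by rewrite (pentagonV mh hg gf) !insl_comp !compA.
Qed.

(** The first beta-theta equation turns theta inside the inserted term into
theta between two factors inserted one after the other. *)
Lemma act_natural_theta h g f : term (h ◁ g)%trm -> term (h ◁ f)%trm ->
  t g != t f -> act_natural (Theta h g f) ((h ◁ g) ◁ f) ((h ◁ f) ◁ g).
Proof.
move=> hg hf ne m H; have mh : term (m ◁ h)%trm by auto_term.
have mhg := (term_beta mh hg).1; have mhf := (term_beta mh hf).1.
have idg := at_id (term_insr hg); have idf := at_id (term_insr hf).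
have [E D] := commP (term_act mh mhg) (term_act mh mhf) ne; split=> //=.
rewrite !insl_comp !compA (beta_theta1V mh hg hf ne) (compL _ D) !compA.
by rewrite (compL _ (theta_nat idf idg (act_arrP mh) mhg mhf ne)) !compA.
Qed.

(** Here [mu_ins] is needed, because mu is inserted as a whole into m. *)
Lemma act_natural_mu f a : term f -> a \in s f ->
  act_natural (Mu f a) (f ◁ Unit a) f.
Proof.
move=> hf af m H; split=> //=; have mf : term (m ◁ f)%trm by auto_term.
have amf : a \in s (m ◁ f)%trm by auto_term.
have fa : term (f ◁ Unit a)%trm by auto_term.
rewrite (compL _ (mu_nat (act_arrP mf) amf)) -(mu_ins mf af) !compA.
rewrite (betaVK mf fa) -compA; symmetry; apply: idr.
by apply: at_comp (act_arrP mf); auto_typed.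
Qed.

Lemma act_natural_lam f : term f ->
  act_natural (Lam f) (Unit (t f) ◁ f) f.
Proof.
move=> hf m H; split=> //=; have mf : term (m ◁ f)%trm by auto_term.
have mI : term (m ◁ Unit (t f))%trm by auto_term.
have If : term (Unit (t f) ◁ f)%trm by auto_term.
suff -> : Id m ◁ Lam f ≈ (Mu m (t f) ◁ Id f) ∘ BetaInv m (Unit (t f)) f by [].
apply: moveR (betaVK mI If) _ _; first by auto_typed.
by rewrite beta_unit //; apply: cancelL (insr_inv m (lamVK hf)) _; auto_typed.
Qed.

Lemma act_natural_comp u v f g h : typed u f g ->
  act_natural u f g -> act_natural v g h -> act_natural (v ∘ u) f h.
Proof.
move=> hu nat_u nat_v m mf; have hm := at_id (term_insl mf).
have [E1 D1] := nat_u m mf.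
have [E2 D2] := nat_v m (term_ins_arrow hu hm mf).
by split; [rewrite E1|rewrite insr_comp (compL _ D2)].
Qed.

Lemma act_natural_ins u v f f' g g' : typed u f f' -> typed v g g' ->
  term (g ◁ f)%trm -> act_natural u f f' -> act_natural v g g' ->
  act_natural (v ◁ u) (g ◁ f) (g' ◁ f').
Proof.
move=> hu hv gf nat_u nat_v m H.
have hm := at_id (term_insl H); have mg : term (m ◁ g)%trm by auto_term.
have mgf := (term_beta mg gf).1.
have [E1 D1] := nat_v m mg; have [E2 D2] := nat_u _ (term_act mg mgf).
split; first by rewrite /= E2 E1.
have act_past : (act_arr m g' ◁ Id f') ∘ ((Id m ◁ v) ◁ u) ≈
    (Id (act m g) ◁ u) ∘ (act_arr m g ◁ Id f).
  by rewrite -!ins_comp D1 (idl hu) (idr hu) (idl (act_arrP mg)).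
rewrite /= !compA (betaV_nat hu hv hm mg gf) (compL _ act_past) -E1 !compA.
by rewrite (compL _ D2).
Qed.

Lemma act_naturalP u f g : typed u f g -> act_natural u f g.
Proof.
elim=> {u f g}.
- by move=> f hf m mf; split=> //; rewrite ins_id (idr (act_arrP mf)).
- by move=> h g f hh hg hf gh fg; apply: act_natural_beta; exact: term_ins.
- move=> h g f hh hg hf gh fg.
  have H1 := term_ins hh hg gh; have H2 := term_ins hg hf fg.
  apply: (act_natural_inv (typed_beta H1 H2) (typed_betaV H1 H2)).
    exact: betaVK.
  exact: act_natural_beta.
- by move=> h g f hh hg hf gh fh; apply: act_natural_theta; exact: term_ins.
- by move=> f a hf af; exact: act_natural_mu.
- move=> f a hf af; apply: (act_natural_inv (at_mu hf af) (at_muV hf af)).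
    exact: muVK.
  exact: act_natural_mu.
- by move=> f hf; exact: act_natural_lam.
- move=> f hf; apply: (act_natural_inv (at_lam hf) (at_lamV hf)).
    exact: lamVK.
  exact: act_natural_lam.
- by move=> u v f g h hu IHu _; exact: act_natural_comp.
- by move=> u v f f' g g' hu IHu hv IHv gf _; exact: act_natural_ins.
Qed.

Lemma typed_aeq u v f g : typed u f g -> typed v f g -> u ≈ v.
Proof.
move=> hu hv; have [hf hg] := arrow_termP hu.
(* The empty normal form: f is recovered from its insertion into it. *)
set n : preterm G := Unit (t f).
have nf : term (n ◁ f)%trm by rewrite /n; auto_term.
have hn := at_id (term_insl nf).
have ng := term_ins_arrow hu hn nf.
have hl : typed (Lam f) (n ◁ f) f by exact: at_lam.
apply: (arrow_epi hl hu hv).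
rewrite -(lam_nat hu) -(lam_nat hv).
suff -> : Id n ◁ u ≈ Id n ◁ v by [].
apply: (arrow_mono (act_arrP ng) (typed_ins hu hn nf) (typed_ins hv hn nf)).
by rewrite (act_naturalP hu nf).2 (act_naturalP hv nf).2.
Qed.

End Coherence.

Theorem mainTheorem2 (G : Type) (alpha : G -> nat) : is_preorder (WOu alpha).
Proof.
move=> f g A B; have [u [hu ->]] := WOu_homP A; have [v [hv ->]] := WOu_homP B.
by apply: class_of_eq; have [E] := typed_aeq hu hv; apply: E; left.
Qed.
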